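(* Let $\mathbb{F}_q$ be the finite field with $q$ elements, $d\ge2$, and $t\in\mathbb{F}_q\setminus\{0\}$. Let $f,g:\mathbb{F}_q^d\times\mathbb{F}_q^d\to\mathbb{R}$ be nonnegative, and set $F(x)=\sum_y f(x,y)$, $G(z)=\sum_w g(z,w)$, $F'(y)=\sum_x f(x,y)$, $G'(w)=\sum_z g(z,w)$. Then $$\left|\sum_{x\cdot z=y\cdot w=t}f(x,y)g(z,w)-q^{-2}\|f\|_1\|g\|_1\right|\le 2q^{d-1}\|f\|_2\|g\|_2+q^{\frac{d-3}{2}}\left(\|F\|_2\|G\|_2+\|F'\|_2\|G'\|_2\right).$$
   Context: $x\cdot y=\sum_{j=1}^d x_jy_j$; the sum on the left runs over all $x,y,z,w\in\mathbb{F}_q^d$ with $x\cdot z=t$ and $y\cdot w=t$. For a function $h$ on a finite set, $\|h\|_1=\sum|h|$ and $\|h\|_2=(\sum|h|^2)^{1/2}$ (sums over all points, no normalization). *)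

(* Defs.v *)
From HB Require Import structures.
From mathcomp Require Import all_boot all_order all_algebra.
From mathcomp Require Import all_classical all_reals all_analysis.

Set Implicit Arguments.
Unset Strict Implicit.
Unset Printing Implicit Defensive.

Import Order.TTheory GRing.Theory Num.Theory.

Local Open Scope ring_scope.

Definition dotv (K : finFieldType) (d : nat) (x y : 'rV[K]_d) : K :=
  \sum_(j < d) x 0 j * y 0 j.

(* Counting-measure norms, without normalization. *)
Definition norm1 (R : realType) (T : finType) (h : T -> R) : R :=
  \sum_(p : T) `|h p|.

Definition norm2 (R : realType) (T : finType) (h : T -> R) : R :=
  Num.sqrt (\sum_(p : T) `|h p| ^+ 2).

Definition marginal1 (R : realType) (S T : finType) (h : S * T -> R) (x : S) : R :=
  \sum_(y : T) h (x, y).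

Definition marginal2 (R : realType) (S T : finType) (h : S * T -> R) (y : T) : R :=
  \sum_(x : S) h (x, y).

(* Main.v *)
Require Import Defs.
From HB Require Import structures.
From mathcomp Require Import all_boot all_order all_algebra.
From mathcomp Require Import ring lra.
From mathcomp Require Import all_classical all_reals all_analysis.

(** Let [A(x,z) = 1] if [x.z = t] and [0] otherwise, [J] the all-ones matrix
    and [E = A - J/q].  Then
    [A (x) A - q^-2 J (x) J = q^-1 (E (x) J + J (x) E) + E (x) E],
    and the first two terms only see the marginals of [f] and [g].  Everything
    follows from the operator norm bound [|E|^2 <= q^(d-1)].  For it, compute
    the Gram matrix [E E^T]: rows indexed by non-proportional vectors are
    orthogonal, and [q^(d-1) I - E E^T] is, up to a nonnegative entry at
    [(0,0)], equal to [q^(d-2)] times the indicator of proportionality, which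
    is positive semidefinite. *)

Set Implicit Arguments.
Unset Strict Implicit.
Unset Printing Implicit Defensive.

Import Order.TTheory GRing.Theory Num.Theory.

Local Open Scope ring_scope.

(** * Finite sums: Cauchy-Schwarz, positivity and operator norms *)

Section FiniteSums.
Variable R : realType.

Lemma sqr_sum (T : finType) (a : T -> R) :
  (\sum_i a i) ^+ 2 = \sum_i \sum_j a i * a j.
Proof. by rewrite expr2 big_distrlr. Qed.

Lemma sum_prod (S T : finType) (F : S * T -> R) :
  \sum_p F p = \sum_x \sum_y F (x, y).
Proof. by rewrite pair_bigA; apply: eq_bigr => -[]. Qed.

Lemma Cauchy_Schwarz_sum (T : finType) (a b : T -> R) :
  (\sum_i a i * b i) ^+ 2 <= (\sum_i a i ^+ 2) * (\sum_i b i ^+ 2).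
Proof.
(* Lagrange's identity: this sum of squares is twice the gap in the inequality. *)
have : 0 <= \sum_i \sum_j (a i * b j - a j * b i) ^+ 2.
  by apply: sumr_ge0 => i _; apply: sumr_ge0 => j _; apply: sqr_ge0.
have -> : \sum_i \sum_j (a i * b j - a j * b i) ^+ 2 =
    (\sum_i a i ^+ 2) * (\sum_i b i ^+ 2)
    + (\sum_i b i ^+ 2) * (\sum_i a i ^+ 2) - 2 * (\sum_i a i * b i) ^+ 2.
  rewrite sqr_sum !big_distrlr mulr_sumr -sumrN -!big_split.
  apply: eq_bigr => i _ /=.
  by rewrite mulr_sumr -sumrN -!big_split; apply: eq_bigr => j _ /=; ring.
lra.
Qed.

Lemma norm2_sqr (T : finType) (h : T -> R) : norm2 h ^+ 2 = \sum_i h i ^+ 2.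
Proof.
rewrite /norm2 sqr_sqrtr; last by apply: sumr_ge0 => i _; apply: exprn_ge0.
by apply: eq_bigr => i _; rewrite real_normK ?num_real.
Qed.

Lemma norm2_ge0 (T : finType) (h : T -> R) : 0 <= norm2 h.
Proof. exact: sqrtr_ge0. Qed.

(** Grouping the points by their value [u] under [p] turns the form into a sum of squares, one for
    each fibre. *)
Lemma eqrel_psd (T U : finType) (p : T -> U) (h : T -> R) :
  0 <= \sum_x \sum_y h x * h y * (p x == p y)%:R.
Proof.
have -> : \sum_x \sum_y h x * h y * (p x == p y)%:R =
    \sum_u (\sum_x h x * (p x == u)%:R) ^+ 2.
  under [RHS]eq_bigr do rewrite sqr_sum.
  rewrite [RHS]exchange_big; apply: eq_bigr => x _ /=.
  rewrite [RHS]exchange_big; apply: eq_bigr => y _ /=.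
  rewrite (bigD1 (p x)) //= eqxx big1 ?addr0 => [|u /negPf hu].
    by rewrite mulr1 mulrA eq_sym.
  by rewrite [p x == u]eq_sym hu mulr0 mul0r.
by apply: sumr_ge0 => u _; apply: sqr_ge0.
Qed.

Definition opnorm_sqr_le (S T : finType) (E : S -> T -> R) (c : R) :=
  forall h : S -> R,
    \sum_z (\sum_x h x * E x z) ^+ 2 <= c * \sum_x h x ^+ 2.

Lemma bilinear_bound (S T : finType) (E : S -> T -> R) (c : R)
    (a : S -> R) (b : T -> R) : 0 <= c -> opnorm_sqr_le E c ->
  `| \sum_x \sum_z a x * b z * E x z | <= Num.sqrt c * (norm2 a * norm2 b).
Proof.
move=> c0 hE.
have -> : \sum_x \sum_z a x * b z * E x z = \sum_z (\sum_x a x * E x z) * b z.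
  rewrite exchange_big; apply: eq_bigr => z _; rewrite mulr_suml.
  by apply: eq_bigr => x _ /=; ring.
rewrite -ler_sqr ?nnegrE ?mulr_ge0 ?sqrtr_ge0 //.
rewrite real_normK ?num_real // !exprMn sqr_sqrtr // !norm2_sqr mulrA.
apply: le_trans (Cauchy_Schwarz_sum _ _) _.
by apply: ler_wpM2r (hE _); apply: sumr_ge0 => i _; apply: sqr_ge0.
Qed.

(** The bound is applied one coordinate at a time: first in the second coordinate with [z] frozen,
    then in the first with [y] frozen. Each use costs a factor [c]. *)
Lemma opnorm_tensor (S T : finType) (E : S -> T -> R) (c : R) :
  0 <= c -> opnorm_sqr_le E c ->
  opnorm_sqr_le (fun p r => E p.1 r.1 * E p.2 r.2) (c ^+ 2).
Proof.
move=> c0 hE h.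
rewrite sum_prod /=.
have -> : \sum_z \sum_w (\sum_p h p * (E p.1 z * E p.2 w)) ^+ 2 =
    \sum_z \sum_w (\sum_y (\sum_x h (x, y) * E x z) * E y w) ^+ 2.
  apply: eq_bigr => z _; apply: eq_bigr => w _; congr (_ ^+ 2).
  rewrite sum_prod /=.
  rewrite exchange_big; apply: eq_bigr => y _; rewrite mulr_suml.
  by apply: eq_bigr => x _; rewrite mulrA.
apply: (@le_trans _ _ (\sum_z c * \sum_y (\sum_x h (x, y) * E x z) ^+ 2)).
  by apply: ler_sum => z _; apply: hE.
rewrite -mulr_sumr expr2 -mulrA; apply: ler_wpM2l => //.
rewrite exchange_big sum_prod /=.
rewrite [X in c * X]exchange_big mulr_sumr.
by apply: ler_sum => y _; apply: hE.
Qed.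

End FiniteSums.

(** * Dot products over a finite field: separation and equidistribution *)

Section DotProduct.
Variables (R : realType) (K : finFieldType) (d : nat).
Implicit Types x y z : 'rV[K]_d.

Lemma dotvDr x y z : dotv x (y + z) = dotv x y + dotv x z.
Proof. by rewrite -big_split; apply: eq_bigr => j _; rewrite mxE mulrDr. Qed.

Lemma dotvZr x (c : K) z : dotv x (c *: z) = c * dotv x z.
Proof. by rewrite /dotv mulr_sumr; apply: eq_bigr => j _; rewrite mxE; ring. Qed.

Lemma dotvZl x (c : K) z : dotv (c *: x) z = c * dotv x z.
Proof. by rewrite /dotv mulr_sumr; apply: eq_bigr => j _; rewrite mxE; ring. Qed.

Lemma dotv0l z : dotv 0 z = 0.
Proof. by rewrite /dotv big1 // => j _; rewrite mxE mul0r. Qed.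

Lemma dotv_delta x j : dotv x (delta_mx 0 j) = x 0 j.
Proof.
rewrite /dotv (bigD1 j) //= mxE !eqxx mulr1 big1 ?addr0 // => i /negPf hi.
by rewrite mxE hi mulr0.
Qed.

Lemma dotv_separate x y : (forall c : K, x != c *: y) ->
  exists z, dotv x z = 1 /\ dotv y z = 0.
Proof.
move=> hxy.
suff [z [hz1 hz2]] : exists z, dotv x z != 0 /\ dotv y z = 0.
  exists ((dotv x z)^-1 *: z).
  by rewrite !dotvZr hz2 mulr0 mulVf.
case: (eqVneq y 0) => [->|/rV0Pn [i hi]].
  have /rV0Pn [j hj] : x != 0 by have := hxy 0; rewrite scale0r.
  by exists (delta_mx 0 j); rewrite dotv_delta dotv0l.
have /rV0Pn [j] : x - (x 0 i / y 0 i) *: y != 0 by rewrite subr_eq0.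
rewrite !mxE => hj.
(* This vector is built to be orthogonal to [y]; its product with [x] is the [j]-th coordinate of
   [x - (x 0 i / y 0 i) *: y], nonzero by the choice of [j]. *)
exists (delta_mx 0 j + (- (y 0 j / y 0 i)) *: delta_mx 0 i).
rewrite !dotvDr !dotvZr !dotv_delta; split; last by field.
by apply: contra_neq hj => <-; field.
Qed.

Lemma sum_shift (F : 'rV[K]_d -> R) z1 :
  #|K|%:R * (\sum_z F z) = \sum_z \sum_(s : K) F (z + s *: z1).
Proof.
rewrite mulr_natl -sumr_const [RHS]exchange_big; apply: eq_bigr => s _ /=.
by rewrite (reindex_inj (addIr (s *: z1))).
Qed.

Lemma cardK_neq0 : #|K|%:R != 0 :> R.
Proof. by rewrite pnatr_eq0 -lt0n ltnW // card_finNzRing_gt1. Qed.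

(** Equidistribution of [dotv x z]: along a direction [z1] with [dotv x z1 = 1], the product takes
    each value of [K] once. The factor [#|K|] on the left avoids the exponent [d - 1]. *)
Lemma sum_dotv x (phi : K -> R) : x != 0 ->
  #|K|%:R * (\sum_z phi (dotv x z)) = #|K|%:R ^+ d * \sum_u phi u.
Proof.
move=> x0; have [z1 [h1 _]] : exists z, dotv x z = 1 /\ dotv (0 : 'rV_d) z = 0.
  by apply: dotv_separate => c; rewrite scaler0.
rewrite (sum_shift _ z1) (eq_bigr (fun=> \sum_u phi u)) => [|z _].
  by rewrite sumr_const card_mx mul1n -[LHS]mulr_natl natrX.
rewrite [RHS](reindex_inj (addrI (dotv x z))) /=.
by apply: eq_bigr => s _; rewrite dotvDr dotvZr h1 mulr1.
Qed.

End DotProduct.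

(** * Gram matrix and operator norm of the discrepancy matrix *)

Section Discrepancy.
Variables (R : realType) (K : finFieldType) (d : nat) (t : K).
Hypothesis t0 : t != 0.
Implicit Types x y z : 'rV[K]_d.

Local Notation q := (#|K|%:R : R).

Definition discr x z : R := (dotv x z == t)%:R - q^-1.

Lemma sum_indicator (u : K) : \sum_(s : K) ((s == u)%:R : R) = 1.
Proof.
by rewrite (bigD1 u) //= eqxx big1 ?addr0 // => s /negPf ->.
Qed.

Lemma sum_const_K (c : R) : \sum_(s : K) c = q * c.
Proof. by rewrite sumr_const mulr_natl. Qed.

(* Shifting by a vector orthogonal to [y] but not to [x] averages
   [discr x] to zero while fixing [discr y]. *)
Lemma gram_separated x y : (forall c : K, x != c *: y) ->
  \sum_z discr x z * discr y z = 0.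
Proof.
move=> /dotv_separate [z1 [h1 h2]].
apply: (mulfI (cardK_neq0 R K)); rewrite mulr0 (sum_shift _ z1).
rewrite big1 // => z _.
rewrite (eq_bigr (fun s => discr y z * ((s == t - dotv x z)%:R - q^-1))).
  rewrite -mulr_sumr sumrB sum_indicator sum_const_K mulfV ?cardK_neq0 //.
  by rewrite subrr mulr0.
move=> s _; rewrite mulrC /discr !dotvDr !dotvZr h1 h2 mulr0 addr0 mulr1.
by rewrite [s == _]eq_sym subr_eq [t == _]eq_sym [s + _]addrC.
Qed.

(** By equidistribution this is a sum over [K] of two centred indicators, at [t / c] and at [t]; as
    [t] is nonzero, these points coincide only for [c = 1]. *)
Lemma gram_proportional y (c : K) : c != 0 -> y != 0 ->
  \sum_z discr (c *: y) z * discr y z = q ^+ d / q * ((c == 1)%:R - q^-1).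
Proof.
move=> c0 y0; have q0 := cardK_neq0 R K.
apply: (mulfI q0).
pose phi (u : K) : R := ((c * u == t)%:R - q^-1) * ((u == t)%:R - q^-1).
rewrite (eq_bigr (fun z => phi (dotv y z))); last first.
  by move=> z _; rewrite /discr dotvZl.
rewrite sum_dotv // (eq_bigr (fun u => (c == 1)%:R * (u == t)%:R
   - q^-1 * (u == t / c)%:R - q^-1 * (u == t)%:R + q^-1 * q^-1)); last first.
  move=> u _; rewrite /phi.
  have -> : (c * u == t) = (u == t / c).
    by rewrite -[RHS](inj_eq (mulfI c0)) mulrCA mulfV // mulr1.
  have [->|] := eqVneq u t; last by move=> _; rewrite /=; ring.
  have -> : (t == t / c) = (c == 1).
    rewrite -(inj_eq (mulIf c0)) divfK // -[X in _ == X]mulr1.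
    by rewrite (inj_eq (mulfI t0)).
  by ring.
rewrite big_split !sumrB -!mulr_sumr !sum_indicator sum_const_K /=.
by field.
Qed.

Lemma gram_zero : \sum_z discr 0 z * discr 0 z = q ^+ d / q * q^-1.
Proof.
rewrite (eq_bigr (fun=> q^-1 * q^-1)) => [|z _].
  by rewrite sumr_const card_mx mul1n -[LHS]mulr_natl natrX mulrA.
by rewrite /discr dotv0l eq_sym (negPf t0) sub0r mulrNN.
Qed.

(** The proportionality class of [x], with 0 alone in its class. Having it as the value of a map
    makes [eqrel_psd] applicable. *)
Definition punctured_line x : {set 'rV[K]_d} :=
  [set c *: x | c in [set~ (0 : K)]]%SET.

Lemma punctured_lineP x y :
  reflect (exists2 c : K, c != 0 & x = c *: y)
          (punctured_line x == punctured_line y).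
Proof.
apply: (iffP eqP) => [e|[c c0 ->]].
  have : x \in punctured_line x.
    by apply/imsetP; exists 1; rewrite ?inE ?oner_neq0 ?scale1r.
  by rewrite e => /imsetP [c]; rewrite !inE => c0 ->; exists c.
apply/setP => v; apply/imsetP/imsetP => -[a]; rewrite !inE => a0 ->.
  by exists (a * c); rewrite ?inE ?mulf_neq0 // scalerA.
exists (a / c); first by rewrite !inE mulf_neq0 ?invr_neq0.
by rewrite scalerA divfK.
Qed.

(** At [(0, 0)] the first two terms give [1 - q^-1] while [gram_zero] requires [q^-1], whence the
    correction [1 - 2 * q^-1]. *)
Lemma gramE x y : \sum_z discr x z * discr y z =
  q ^+ d / q * ((x == y)%:R - q^-1 * (punctured_line x == punctured_line y)%:R
    - (1 - 2 * q^-1) * ((x == 0) && (y == 0))%:R).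
Proof.
case: punctured_lineP => [[c c0 ->]|h].
  case: (eqVneq y 0) => [->|y0].
    by rewrite scaler0 gram_zero eqxx /=; ring.
  rewrite gram_proportional // andbF mulr0 subr0 mulr1.
  congr (_ * ((nat_of_bool _)%:R - _)).
  rewrite -[X in _ == X :> 'rV_d]scale1r -[RHS]subr_eq0 -scalerBl scaler_eq0.
  by rewrite (negPf y0) orbF subr_eq0.
have hxy : x != y.
  by apply/eqP => e; apply: h; exists 1; rewrite ?oner_neq0 ?scale1r.
have -> : (x == 0) && (y == 0) = false.
  by apply/negP => /andP [/eqP ex /eqP ey]; rewrite ex ey eqxx in hxy.
rewrite (negPf hxy) !mulr0 !subr0 mulr0.
(* If [x = 0], it is a multiple of [y], so separation is used with the roles exchanged: [y] is not a
   multiple of 0. *)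
case: (eqVneq x 0) => [x0|x0].
  under eq_bigr do rewrite mulrC.
  apply: gram_separated => c; apply/eqP => e; move: hxy.
  by rewrite e x0 scaler0 eqxx.
apply: gram_separated => c; apply/eqP => e; apply: h; exists c => //.
by apply: contra_neq x0 => c0; rewrite e c0 scale0r.
Qed.

Lemma discr_opnorm : opnorm_sqr_le discr (q ^+ d / q).
Proof.
move=> h.
have q2 : 2 <= q by rewrite ler_nat card_finNzRing_gt1.
have qgt0 : 0 < q by lra.
have -> : \sum_z (\sum_x h x * discr x z) ^+ 2 =
    \sum_x \sum_y h x * h y * \sum_z discr x z * discr y z.
  under eq_bigr do rewrite sqr_sum.
  rewrite exchange_big; apply: eq_bigr => x _ /=.
  rewrite exchange_big; apply: eq_bigr => y _ /=.
  by rewrite mulr_sumr; apply: eq_bigr => z _; ring.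
have -> : \sum_x \sum_y h x * h y * \sum_z discr x z * discr y z =
    q ^+ d / q * (\sum_x \sum_y h x * h y * (x == y)%:R
     - q^-1 * (\sum_x \sum_y h x * h y *
         (punctured_line x == punctured_line y)%:R)
     - (1 - 2 * q^-1) *
         \sum_x \sum_y h x * h y * ((x == 0) && (y == 0))%:R).
  rewrite !mulr_sumr -!sumrB mulr_sumr; apply: eq_bigr => x _.
  rewrite !mulr_sumr -!sumrB mulr_sumr; apply: eq_bigr => y _.
  by rewrite gramE; ring.
apply: ler_wpM2l; first by rewrite divr_ge0 ?exprn_ge0 // ltW.
have -> : \sum_x \sum_y h x * h y * (x == y)%:R = \sum_x h x ^+ 2.
  apply: eq_bigr => x _; rewrite (bigD1 x) //= eqxx mulr1 big1 ?addr0 ?expr2 //.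
  by move=> y /negPf hy; rewrite eq_sym hy mulr0.
have -> : \sum_x \sum_y h x * h y * ((x == 0) && (y == 0))%:R = h 0 ^+ 2.
  rewrite (bigD1 0) //= [X in _ + X]big1 ?addr0; last first.
    by move=> x /negPf hx; rewrite big1 // => y _; rewrite hx mulr0.
  rewrite (bigD1 0) //= eqxx mulr1 big1 ?addr0 ?expr2 //.
  by move=> y /negPf hy; rewrite hy mulr0.
(* Both subtracted terms are nonnegative: the first by [eqrel_psd], the second because [2 <= q]. *)
rewrite -addrA -opprD gerBl addr_ge0 //.
  by apply: mulr_ge0; [rewrite invr_ge0 ltW | apply: eqrel_psd].
apply: mulr_ge0; last exact: sqr_ge0.
by rewrite subr_ge0 ler_pdivrMr // mul1r.
Qed.

End Discrepancy.

(** * The power of [q] and the final estimate *)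

(** Splits [(d - 3) / 2] as [-1 + (d - 1) / 2]: the weight of the marginal terms times the norm
    bound for [discr]. *)
Lemma powR_half_deg (R : realType) (q : R) (d : nat) : 0 < q ->
  q `^ ((d%:R - 3) / 2) = q^-1 * Num.sqrt (q ^+ d / q).
Proof.
move=> q0; rewrite -powR12_sqrt ?divr_ge0 ?exprn_ge0 ?ltW //.
rewrite -powR_mulrn ?ltW // -(powR_inv1 (ltW q0)) -powRD; last first.
  by rewrite (gt_eqF q0) implybT.
rewrite -powRrM -powRD ?(gt_eqF q0) ?implybT //; congr (_ `^ _).
by field.
Qed.

Theorem theorem3p2 (R : realType) (K : finFieldType) (q d : nat)
    (hq : #|K| = q) (hd : (2 <= d)%N) (t : K) (ht : t != 0)
    (f g : 'rV[K]_d * 'rV[K]_d -> R)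
    (hf : forall p, 0 <= f p) (hg : forall p, 0 <= g p) :
  `| \sum_(x : 'rV[K]_d) \sum_(y : 'rV[K]_d)
       \sum_(z : 'rV[K]_d | dotv x z == t) \sum_(w : 'rV[K]_d | dotv y w == t)
         f (x, y) * g (z, w)
     - q%:R ^- 2 * norm1 f * norm1 g |
  <= 2 * q%:R ^+ (d - 1) * norm2 f * norm2 g
     + q%:R `^ ((d%:R - 3) / 2)
       * (norm2 (marginal1 f) * norm2 (marginal1 g)
          + norm2 (marginal2 f) * norm2 (marginal2 g)).
Proof.
subst q; set q : R := #|K|%:R.
have q0 : 0 < q by rewrite ltr0n ltnW // card_finNzRing_gt1.
pose c : R := q ^+ d / q.
have c0 : 0 <= c by rewrite divr_ge0 ?exprn_ge0 // ltW.
have cE : q ^+ (d - 1) = c.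
  by rewrite /c -(subnK (ltnW hd)) addn1 exprSr mulfK ?gt_eqF // subn1.
pose E := discr R t : 'rV[K]_d -> 'rV[K]_d -> R.
have hE : opnorm_sqr_le E c by apply: discr_opnorm.
have -> : \sum_(x : 'rV[K]_d) \sum_(y : 'rV[K]_d)
       \sum_(z : 'rV[K]_d | dotv x z == t) \sum_(w : 'rV[K]_d | dotv y w == t)
         f (x, y) * g (z, w) - q ^- 2 * norm1 f * norm1 g =
    \sum_p \sum_r f p * g r * (E p.1 r.1 * E p.2 r.2)
    + q^-1 * (\sum_x \sum_z marginal1 f x * marginal1 g z * E x z
       + \sum_y \sum_w marginal2 f y * marginal2 g w * E y w).
  have -> : norm1 f = \sum_p f p by apply: eq_bigr => p _; rewrite ger0_norm.
  have -> : norm1 g = \sum_p g p by apply: eq_bigr => p _; rewrite ger0_norm.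
  have -> : \sum_x \sum_z marginal1 f x * marginal1 g z * E x z =
      \sum_p \sum_r f p * g r * E p.1 r.1.
    rewrite [RHS]sum_prod /=.
    apply: eq_bigr => x _; rewrite exchange_big /=.
    rewrite [RHS]sum_prod /=.
    apply: eq_bigr => z _; rewrite big_distrlr mulr_suml [RHS]exchange_big /=.
    by apply: eq_bigr => y _; rewrite mulr_suml.
  have -> : \sum_y \sum_w marginal2 f y * marginal2 g w * E y w =
      \sum_p \sum_r f p * g r * E p.2 r.2.
    rewrite [RHS]sum_prod /=.
    rewrite [RHS]exchange_big; apply: eq_bigr => y _ /=.
    rewrite [RHS]exchange_big /=.
    rewrite [RHS]sum_prod /=.
    rewrite [RHS]exchange_big.
    apply: eq_bigr => w _; rewrite big_distrlr mulr_suml [RHS]exchange_big /=.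
    by apply: eq_bigr => x _; rewrite mulr_suml.
  have -> : \sum_(x : 'rV[K]_d) \sum_(y : 'rV[K]_d)
       \sum_(z : 'rV[K]_d | dotv x z == t) \sum_(w : 'rV[K]_d | dotv y w == t)
         f (x, y) * g (z, w) =
     \sum_p \sum_r
       f p * g r * ((dotv p.1 r.1 == t)%:R * (dotv p.2 r.2 == t)%:R).
    rewrite pair_bigA; apply: eq_bigr => -[x y] _ /=.
    rewrite pair_big_dep /= big_mkcond; apply: eq_bigr => -[z w] _ /=.
    by do 2!case: (_ == t); rewrite /= ?mulr1 ?mulr0 ?mul0r.
  (* All terms are now double sums over [p] and [r], so the decomposition is checked entry by
     entry. *)
  rewrite -mulrA big_distrlr !mulr_sumr -sumrB -big_split mulr_sumr -big_split.
  apply: eq_bigr => p _ /=.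
  rewrite !mulr_sumr -sumrB -big_split mulr_sumr -big_split.
  apply: eq_bigr => r _ /=; rewrite /E /discr -/q.
  by field; rewrite gt_eqF.
have h0 := bilinear_bound f g (exprn_ge0 2 c0) (opnorm_tensor c0 hE).
have h1 := bilinear_bound (marginal1 f) (marginal1 g) c0 hE.
have h2 := bilinear_bound (marginal2 f) (marginal2 g) c0 hE.
rewrite sqrtr_sqr (ger0_norm c0) in h0.
rewrite cE powR_half_deg // -/c; clearbody c.
apply: le_trans (ler_normD _ _) _; apply: lerD.
  (* The tensor term is bounded with constant 1, which is then relaxed to 2. *)
  apply: le_trans h0 _; rewrite -!mulrA.
  have := mulr_ge0 c0 (mulr_ge0 (norm2_ge0 f) (norm2_ge0 g)).
  by move=> /ler_peMl; apply; rewrite ler1n.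
rewrite normrM gtr0_norm ?invr_gt0 // -[leRHS]mulrA.
apply: ler_wpM2l; first by rewrite invr_ge0 ltW.
by rewrite [leRHS]mulrDr; apply: le_trans (ler_normD _ _) (lerD h1 h2).
Qed.
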